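(* Let $P,K:\mathbb{N}_0\to\mathbb{N}_0$ be an admissible scaling with deviation function $\alpha_n := n\frac{K_n^2}{P_n}-\log n$, so that $\frac{K_n^2}{P_n}=\frac{\log n+\alpha_n}{n}$ for all $n$. Then $$\lim_{n\to\infty}P(n;\theta_n)=0\quad\text{if }\lim_{n\to\infty}\alpha_n=-\infty .$$ On the other hand, if there exists $\sigma>0$ such that $\sigma n\le P_n$ for all $n$ sufficiently large, then $$\lim_{n\to\infty}P(n;\theta_n)=1\quad\text{if }\lim_{n\to\infty}\alpha_n=+\infty .$$
   Context: For positive integers $K\le P$ and $n\ge 2$, write $\theta=(K,P)$. The random key graph $\mathbb{K}(n;\theta)$ on vertex set $\{1,\dots,n\}$ is constructed as follows. Let $K_1(\theta),\dots,K_n(\theta)$ be i.i.d. random sets, each uniformly distributed over the collection of all $K$-element subsets of $\{1,\dots,P\}$. Distinct nodes $i,j$ are adjacent if and only if $K_i(\theta)\cap K_j(\theta)\neq\emptyset$. Write $P(n;\theta)$ for the probability that $\mathbb{K}(n;\theta)$ is connected. A scaling is a pair of maps $P,K:\mathbb{N}_0\to\mathbb{N}_0$ with $K_n\le P_n$ for all $n$; we write $\theta_n=(K_n,P_n)$. A scaling is admissible if $K_n\ge 2$ for all $n$ sufficiently large. *)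

(* Defs.v *)
From HB Require Import structures.
From mathcomp Require Import all_boot all_order all_algebra.
From mathcomp Require Import all_classical all_reals all_analysis.
Set Implicit Arguments.
Unset Strict Implicit.
Unset Printing Implicit Defensive.
Import Order.TTheory GRing.Theory Num.Theory numFieldNormedType.Exports.
Local Open Scope classical_set_scope.
Local Open Scope ring_scope.

Definition key_rings (K P : nat) : {set {set 'I_P}} :=
  [set S : {set 'I_P} | #|S| == K].

Definition uniform_pmf (R : realType) (T : finType) (A : {set T}) (x : T) : R :=
  if x \in A then #|A|%:R^-1 else 0.

(* Probability of the event E for n i.i.d. random elements with common mass
   function p: their joint law is the n-fold product of p. *)
Definition iid_prob (R : realType) (n : nat) (T : finType) (p : T -> R)
    (E : pred {ffun 'I_n -> T}) : R :=
  \sum_(k : {ffun 'I_n -> T} | E k) \prod_(i < n) p (k i).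

(* Nodes and keys are numbered from 0: node set 'I_n, key pool 'I_P. *)
Definition key_graph (n P : nat) (k : {ffun 'I_n -> {set 'I_P}}) : rel 'I_n :=
  fun i j => (i != j) && (k i :&: k j != finset.set0).

Definition connected_graph (V : finType) (e : rel V) : bool :=
  [forall i, forall j, connect e i j].

Definition prob_connected (R : realType) (n K P : nat) : R :=
  iid_prob (@uniform_pmf R _ (key_rings K P))
    (fun k : {ffun 'I_n -> {set 'I_P}} => connected_graph (key_graph k)).

Definition scaling (P K : nat -> nat) : Prop := forall n, (K n <= P n)%N.

Definition admissible (K : nat -> nat) : Prop :=
  \forall n \near \oo, (2 <= K n)%N.

Definition deviation (R : realType) (P K : nat -> nat) (n : nat) : R :=
  n%:R * ((K n)%:R ^+ 2 / (P n)%:R) - ln n%:R.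

(* Main.v *)
Require Import Defs.
From HB Require Import structures.
From mathcomp Require Import all_boot all_order all_algebra.
From mathcomp Require Import all_classical all_reals all_analysis.
From mathcomp Require Import ring lra zify.
Set Implicit Arguments.
Unset Strict Implicit.
Unset Printing Implicit Defensive.
Import Order.TTheory GRing.Theory Num.Theory numFieldNormedType.Exports.
Local Open Scope ring_scope.

(* Below the threshold, Chebyshev's inequality applied to the number of isolated
   nodes is enough: for two nodes to be isolated the other n - 2 rings must avoid
   2K keys, and by log-concavity of the binomial coefficients this costs at least
   the square of the price for one node.

   Above the threshold, a disconnected graph has a set S of r <= n/2 nodes with no
   edge to its complement.  Conditionally on the union U of the rings in S, this
   has probability at most z^|U| with z = exp (- K (n - r) / P).  Expanding z^|U|
   as the probability that a z-random set of keys contains U, its mean is at most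
   the moment of order rK of Bin(P, z) / P, hence at most
   (z + (rK/P) (1 - z))^(rK).  Summed against 'C(n, r) this is small as long as
   rK/P <= 2 exp(-9); for larger r a union bound over the small sets of keys
   shows that U covers a fixed fraction of the pool.  The hypothesis
   sigma n <= P forces K to tend to infinity, which makes both estimates work. *)

(** * Means over i.i.d. families and resampling of coordinates *)

Definition iid_mean (R : realType) (n : nat) (T : finType) (p : T -> R)
    (f : {ffun 'I_n -> T} -> R) : R :=
  \sum_(k : {ffun 'I_n -> T}) f k * \prod_(i < n) p (k i).

Section IidMean.
Variables (R : realType) (n : nat) (T : finType) (p : T -> R).
Hypothesis p_ge0 : forall t, 0 <= p t.
Hypothesis p_sum1 : \sum_t p t = 1.
Implicit Types (f g : {ffun 'I_n -> T} -> R) (k : {ffun 'I_n -> T}).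
Local Notation mean := (@iid_mean R n T p).

Lemma iid_probE (E : pred {ffun 'I_n -> T}) :
  iid_prob p E = mean (fun k => (E k)%:R).
Proof.
rewrite /iid_prob /iid_mean big_mkcond; apply: eq_bigr => k _.
by case: (E k); rewrite ?mul1r ?mul0r.
Qed.

Lemma iid_mean_prod (h : 'I_n -> T -> R) :
  mean (fun k => \prod_i h i (k i)) = \prod_i \sum_t h i t * p t.
Proof.
rewrite bigA_distr_bigA /=; apply: eq_bigr => k _.
by rewrite -big_split.
Qed.

Lemma iid_mean_const c : mean (fun=> c) = c.
Proof.
rewrite /iid_mean -mulr_sumr.
rewrite -(bigA_distr_bigA (fun (_ : 'I_n) t => p t)) /=.
by rewrite p_sum1 big1_eq mulr1.
Qed.

Lemma weight_ge0 k : 0 <= \prod_(i < n) p (k i).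
Proof. by apply: prodr_ge0. Qed.

(** Families of weight zero contribute nothing, so the comparison is only asked on the support;
    later this gives every ring exactly [K] keys. *)
Lemma ler_iid_mean f g :
  (forall k, (forall i, 0 < p (k i)) -> f k <= g k) -> mean f <= mean g.
Proof.
move=> fg; apply: ler_sum => k _.
have [/forallP /= pk|] := boolP [forall i, 0 < p (k i)].
  by rewrite ler_wpM2r ?weight_ge0 ?fg.
rewrite negb_forall => /existsP[i]; rewrite lt_neqAle p_ge0 andbT negbK => /eqP pk0.
by rewrite (bigD1 i) //= -pk0 !(mul0r, mulr0).
Qed.

Lemma eq_iid_mean f g :
  (forall k, (forall i, 0 < p (k i)) -> f k = g k) -> mean f = mean g.
Proof. by move=> fg; apply/le_anti/andP; split;
  apply: ler_iid_mean => k /fg ->. Qed.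

Lemma iid_meanD f g : mean (fun k => f k + g k) = mean f + mean g.
Proof. by rewrite -big_split; apply: eq_bigr => k _; rewrite mulrDl. Qed.

Lemma iid_meanZ c f : mean (fun k => c * f k) = c * mean f.
Proof. by rewrite mulr_sumr; apply: eq_bigr => k _; rewrite mulrA. Qed.

Lemma iid_mean_sum (I : finType) (A : pred I) (F : I -> {ffun 'I_n -> T} -> R) :
  mean (fun k => \sum_(i | A i) F i k) = \sum_(i | A i) mean (F i).
Proof. by rewrite exchange_big; apply: eq_bigr => k _; rewrite mulr_suml. Qed.

Definition splice (S : {set 'I_n}) k k' : {ffun 'I_n -> T} :=
  [ffun i => if i \in S then k i else k' i].

(* The map (k, k') |-> (splice S k k', splice S k' k) is a weight-preserving
   involution, so resampling the coordinates outside S does not change means. *)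
Lemma iid_mean_resample (S : {set 'I_n}) f :
  mean f = mean (fun k => mean (fun k' => f (splice S k k'))).
Proof.
pose w k := \prod_(i < n) p (k i).
pose h (u : {ffun 'I_n -> T} * {ffun 'I_n -> T}) :=
  (splice S u.1 u.2, splice S u.2 u.1).
have hK : involutive h.
  by case=> a b; congr pair; apply/ffunP => i; rewrite !ffunE /=; case: (i \in S).
have hw u : w (h u).1 * w (h u).2 = w u.1 * w u.2.
  rewrite /w -!big_split /=; apply: eq_bigr => i _; rewrite !ffunE.
  by case: (i \in S) => //; rewrite mulrC.
transitivity (\sum_k \sum_k' f k * (w k * w k')).
  apply: eq_bigr => k _; rewrite -mulr_sumr -mulr_sumr; congr (_ * _).
  rewrite -[LHS]mulr1; congr (_ * _).
  by rewrite -(iid_mean_const 1); apply: eq_bigr => k' _; rewrite mul1r.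
rewrite pair_bigA (reindex_inj (inv_inj hK)) /=.
under eq_bigr do rewrite hw.
rewrite -(pair_bigA _ (fun a b => f (splice S a b) * (w a * w b))) /=.
apply: eq_bigr => k _; rewrite mulr_suml; apply: eq_bigr => k' _.
by rewrite /w; ring.
Qed.

End IidMean.

(** * Inequalities between binomial coefficients *)

(** In falling factorials the inequality holds factor by factor: (v - i) P <= (P - i) v. *)
Lemma bin_mul_exp_le (v P K : nat) : (v <= P)%N -> ('C(v, K) * P ^ K <= 'C(P, K)
  * v ^ K)%N.
Proof.
move=> vP; rewrite -(leq_pmul2r (fact_gt0 K)) mulnAC bin_ffact [leqRHS]mulnAC
  bin_ffact.
rewrite !ffact_prod -[K in (P ^ K)%N]card_ord -[K in (v ^ K)%N]card_ord
  -!prod_nat_const -!big_split /=.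
apply: leq_prod => i _.
by rewrite !mulnBl (mulnC P v) leq_sub2l // leq_mul2l vP orbT.
Qed.

(** Factor by factor in the falling factorials this is y (y + 2u) <= (y + u)^2; when the subtraction
    truncates, the left side is zero. *)
Lemma bin_log_concave (P u K : nat) :
  ('C(P - u - u, K) * 'C(P, K) <= 'C(P - u, K) ^ 2)%N.
Proof.
have K0 := fact_gt0 K.
rewrite -(leq_pmul2r K0) -(leq_pmul2r K0).
rewrite [leqLHS](_ : _ = ('C(P - u - u, K) * K`!) * ('C(P, K) * K`!))%N;
  last by ring.
rewrite [leqRHS](_ : _ = ('C(P - u, K) * K`!) * ('C(P - u, K) * K`!))%N;
  last by ring.
rewrite !bin_ffact !ffact_prod -!big_split /=; apply: leq_prod => i _.
have [|] := leqP (P - i) (u + u); first by move=> ?;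
  rewrite (_ : P - u - u - i = 0)%N //; lia.
move=> h; have -> : (P - i = (P - u - u - i) + (u + u))%N by lia.
have -> : (P - u - i = (P - u - u - i) + u)%N by lia.
by nia.
Qed.

(** Pascal's rule is applied [u] times, and each step loses at most 'C(P - 1, K). *)
Lemma bin_le_shift (P u K : nat) : (u <= P)%N ->
  ('C(P, K.+1) <= 'C(P - u, K.+1) + u * 'C(P.-1, K))%N.
Proof.
elim: u => [|u IH] uP; first by rewrite subn0 mul0n addn0.
apply: (leq_trans (IH (ltnW uP))).
have -> : (P - u = (P - u.+1).+1)%N by lia.
rewrite binS mulSn addnA leq_add2r leq_add2l; apply: leq_bin2l; lia.
Qed.

(** * A single uniform key ring *)

Section UniformRings.
Variables (R : realType) (K P : nat).
Hypothesis KP : (K <= P)%N.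

Definition subset_prob (v : nat) : R := 'C(v, K)%:R / 'C(P, K)%:R.
Local Notation ring_pmf := (@uniform_pmf R _ (key_rings K P)).

Lemma card_key_rings : #|key_rings K P| = 'C(P, K).
Proof. by rewrite /key_rings card_draws card_ord. Qed.

Lemma binR_gt0 : 0 < 'C(P, K)%:R :> R.
Proof. by rewrite ltr0n bin_gt0. Qed.

Lemma ring_pmf_ge0 t : 0 <= ring_pmf t.
Proof. by rewrite /uniform_pmf; case: ifP => // _; rewrite invr_ge0. Qed.

Lemma ring_pmf_gt0 t : 0 < ring_pmf t -> #|t| = K.
Proof. by rewrite /uniform_pmf inE; case: eqP => //; rewrite ltxx. Qed.

Lemma ring_pmf_subset (Z : {set 'I_P}) :
  \sum_(t : {set _}) (t \subset Z)%:R * ring_pmf t = subset_prob #|Z|.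
Proof.
rewrite /subset_prob -(cards_draws Z K) -sum1_card natr_sum mulr_suml.
rewrite [RHS]big_mkcond; apply: eq_bigr => t _.
rewrite /uniform_pmf card_key_rings !inE.
by case: (t \subset Z); case: (#|t| == K); rewrite ?mul1r ?mul0r ?mulr0.
Qed.

Lemma ring_pmf_sum1 : \sum_t ring_pmf t = 1.
Proof.
have := ring_pmf_subset [set: 'I_P]; rewrite /subset_prob cardsT card_ord divff
  ?gt_eqF ?binR_gt0 //.
by move=> <-; apply: eq_bigr => t _; rewrite finset.subsetT mul1r.
Qed.

Lemma subset_prob_ge0 v : 0 <= subset_prob v.
Proof. by rewrite divr_ge0. Qed.

Lemma subset_prob_le_exp v : (v <= P)%N -> subset_prob v <= (v%:R / P%:R) ^+ K.
Proof.
move=> vP; have [P0|P0] := posnP P.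
  by rewrite /subset_prob (_ : K = 0%N) ?bin0 ?divr1 ?expr0 //; lia.
rewrite /subset_prob expr_div_n ler_pdivrMr ?binR_gt0 // mulrAC ler_pdivlMr
  ?exprn_gt0 ?ltr0n //.
by rewrite -!natrX -!natrM ler_nat [leqRHS]mulnC bin_mul_exp_le.
Qed.

Lemma subset_prob_sqr u : subset_prob (P - u - u) <= subset_prob (P - u) ^+ 2.
Proof.
rewrite /subset_prob expr_div_n ler_pdivrMr ?binR_gt0 // mulrAC.
rewrite ler_pdivlMr ?exprn_gt0 ?binR_gt0 //.
rewrite -!natrX -!natrM ler_nat expnS expn1 mulnA leq_mul2r; apply/orP; right.
by rewrite bin_log_concave.
Qed.

(** Union bound: each of the [u] excluded keys lies in the ring with probability 'C(P - 1, K - 1) /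
    'C(P, K) = K / P. *)
Lemma subset_prob_ge u : (0 < K)%N -> (u <= P)%N ->
  1 - u%:R * K%:R / P%:R <= subset_prob (P - u).
Proof.
move=> K0 uP; have P0 : (0 < P)%N := leq_trans K0 KP.
rewrite /subset_prob ler_pdivlMr ?binR_gt0 // mulrBl mul1r lerBlDr.
have -> : u%:R * K%:R / P%:R * 'C(P, K)%:R = u%:R * 'C(P.-1, K.-1)%:R :> R.
  rewrite -!mulrA; congr (_ * _).
  apply: (mulfI (_ : P%:R != 0)); first by rewrite pnatr_eq0 -lt0n.
  rewrite -natrM mul_bin_diag prednK // natrM.
  by field; rewrite pnatr_eq0 -lt0n.
rewrite -natrM -natrD ler_nat.
by have := bin_le_shift K.-1 uP; rewrite prednK.
Qed.

End UniformRings.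

(** * Sums and products over subsets, by size *)

Lemma sum_set_card (R : realType) (T : finType) (f : nat -> R) :
  \sum_(A : {set T}) f #|A| = \sum_(b < #|T|.+1) f b *+ 'C(#|T|, b).
Proof.
rewrite (partition_big (fun A : {set T} => inord #|A| : 'I_#|T|.+1) predT) //=.
apply: eq_bigr => b _.
rewrite -(card_draws T b) -sumr_const.
have cardA (A : {set T}) : (inord #|A| == b :> 'I_#|T|.+1) = (#|A| == b).
  by rewrite -val_eqE /= inordK // ltnS max_card.
apply: eq_big => [A|A]; rewrite cardA ?inE //.
by move=> /eqP ->.
Qed.

Lemma prod_set_if (R : realType) (T : finType) (A : {set T}) (x y : R) :
  \prod_i (if i \in A then x else y) = x ^+ #|A| * y ^+ (#|T| - #|A|).
Proof.
rewrite (bigID (mem A)) /=; congr (_ * _).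
  by rewrite -prodr_const; apply: eq_bigr => i ->.
rewrite -(cardsC A) addKn -prodr_const.
apply: eq_big => i; first by rewrite inE.
by move=> /negbTE ->.
Qed.

(** * Unions of rings and sets of nodes without outgoing edges *)

Section RingUnion.
Variables (R : realType) (n K P : nat).
Hypothesis KP : (K <= P)%N.
Local Notation ring_pmf := (@uniform_pmf R _ (key_rings K P)).
Local Notation mean := (@iid_mean R n _ ring_pmf).
Local Notation subset_prob := (subset_prob R K P).
Implicit Types (S : {set 'I_n}) (Z : {set 'I_P}) (k : {ffun 'I_n -> {set 'I_P}}).
Let pge0 := @ring_pmf_ge0 R K P.
Let psum1 := ring_pmf_sum1 R KP.

Definition ring_union S k : {set 'I_P} := (\bigcup_(i in S) k i)%SET.

(** No edge leaves [S]. Phrased through the union of the rings in [S], so that given this union it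
    is a conjunction of independent events, one for each node outside [S]. *)
Definition separated S k : bool :=
  [forall j, (j \notin S) ==> (k j \subset ~: ring_union S k)].

Lemma ring_union_splice S k k' : ring_union S (splice S k k') = ring_union S k.
Proof. by apply: eq_bigr => i iS; rewrite ffunE iS. Qed.

Lemma mean_subset_family S Z :
  mean (fun k => \prod_i (if i \in S then (k i \subset Z)%:R else 1)) =
  subset_prob #|Z| ^+ #|S|.
Proof.
rewrite (iid_mean_prod _ (fun i (t : {set 'I_P}) => if i \in S then (t \subset
  Z)%:R else 1)).
have := prod_set_if S (subset_prob #|Z|) 1; rewrite expr1n mulr1 => <-.
apply: eq_bigr => i _; case: ifP => _; first exact: ring_pmf_subset.
by rewrite -[RHS]psum1; apply: eq_bigr => t _; rewrite mul1r.
Qed.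

Lemma ring_union_subsetE S Z k : (ring_union S k \subset Z)%:R =
  \prod_i (if i \in S then (k i \subset Z)%:R else 1) :> R.
Proof.
rewrite -big_mkcond /=.
have [/finset.bigcupsP sub|] := boolP (ring_union S k \subset Z).
  by rewrite big1 // => i /sub ->.
move=> /finset.bigcupsP nsub.
have [/existsP[i /andP[iS niZ]]|none] := boolP [exists i, (i \in S) && ~~ (k i
  \subset Z)].
  by rewrite (bigD1 i) //= (negbTE niZ) mul0r.
case: nsub => i iS; apply/negPn; move/existsPn: none => /(_ i).
by rewrite iS /= => /negbTE ->.
Qed.

Lemma mean_ring_union_subset S Z :
  mean (fun k => (ring_union S k \subset Z)%:R) = subset_prob #|Z| ^+ #|S|.
Proof.
rewrite -mean_subset_family; apply: eq_iid_mean => // k _.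
exact: ring_union_subsetE.
Qed.

(** Conditioning on the rings in [S]: the other n - |S| rings are resampled, and each must avoid the
    union. The weight [f] allows restricting to an event about the union, as needed for pairs of
    isolated nodes. *)
Lemma mean_separated S (f : {set 'I_P} -> R) :
  mean (fun k => f (ring_union S k) * (separated S k)%:R) =
  mean (fun k => f (ring_union S k) *
                 subset_prob (P - #|ring_union S k|) ^+ (n - #|S|)).
Proof.
rewrite (iid_mean_resample psum1 S); apply: eq_iid_mean => // k _.
set U := ring_union S k.
have -> : (n - #|S| = #|~: S|)%N by have := cardsC S; rewrite card_ord; lia.
have -> : (P - #|U| = #|~: U|)%N by have := cardsC U; rewrite card_ord; lia.
rewrite -mean_subset_family -iid_meanZ; apply: eq_iid_mean => // k' _.
rewrite ring_union_splice -/U; congr (_ * _).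
rewrite -ring_union_subsetE; congr (_ %:R); congr nat_of_bool.
apply/forallP/finset.bigcupsP => /= [sep i | sub i].
  by rewrite inE => /negbTE iS; have := sep i;
    rewrite iS ring_union_splice ffunE iS.
apply/implyP => /negbTE iS; rewrite ring_union_splice ffunE iS.
by apply: sub; rewrite inE iS.
Qed.

Lemma expr_card_mixture (z : R) (A : {set 'I_P}) :
  z ^+ #|A| = \sum_(Z : {set 'I_P})
    z ^+ #|Z| * (1 - z) ^+ (P - #|Z|) * (A \subset Z)%:R.
Proof.
(* Each key is either kept, with factor z, or dropped, with a factor 1 - z that vanishes on keys of
   [A]; distributing the product sums over the kept set [Z]. *)
have -> : z ^+ #|A| = \prod_(x : 'I_P) (z + (1 - z) * (x \notin A)%:R).
  have := prod_set_if A z 1; rewrite expr1n mulr1 => <-.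
  by apply: eq_bigr => x _; case: (x \in A); rewrite /= ?mulr0 ?mulr1 ?addr0 //
    addrC subrK.
rewrite bigA_distr /=; apply: eq_bigr => Z _.
have [/fintype.subsetP AZ|] := boolP (A \subset Z).
  rewrite mulr1 -[P in (P - _)%N]card_ord -prod_set_if; apply: eq_bigr => x _.
  by case: ifP => // /negbT xZ; rewrite (contra (AZ x) xZ) mulr1.
move=> /subsetPn[x xA xZ]; rewrite mulr0 (bigD1 x) //= (negbTE xZ) xA /=.
by rewrite mulr0 mul0r.
Qed.

Lemma mean_expr_ring_union S (z : R) :
  mean (fun k => z ^+ #|ring_union S k|) =
  \sum_(Z : {set 'I_P}) z ^+ #|Z| * (1 - z) ^+ (P - #|Z|) * subset_prob #|Z| ^+
    #|S|.
Proof.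
under [RHS]eq_bigr do rewrite -mean_ring_union_subset -iid_meanZ.
rewrite -iid_mean_sum; apply: eq_iid_mean => // k _.
exact: expr_card_mixture.
Qed.

End RingUnion.

(** * Moments of shifted binomial variables *)

(** For z in [0, 1], the moment of order [m] of k + Bin(N, z). *)
Definition binomial_moment (R : realType) (z : R) (N k m : nat) : R :=
  \sum_(b < N.+1) (k + b)%:R ^+ m * (z ^+ b * (1 - z) ^+ (N - b)) *+ 'C(N, b).

Lemma binomial_moment0 (R : realType) (z : R) N k : binomial_moment z N k 0 = 1.
Proof.
transitivity ((1 - z + z) ^+ N); last by rewrite subrK expr1n.
by rewrite exprDn; apply: eq_bigr => b _; rewrite expr0 mul1r mulrC.
Qed.

(** One factor k + b is split off. The part with b is size-biased: b 'C(N, b) = N 'C(N - 1, b - 1)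
    replaces Bin(N, z) by 1 + Bin(N - 1, z), whence the shift k + 1. *)
Lemma binomial_momentS (R : realType) (z : R) N k m :
  binomial_moment z N k m.+1 = k%:R * binomial_moment z N k m +
    N%:R * z * binomial_moment z N.-1 k.+1 m.
Proof.
have -> : binomial_moment z N k m.+1 = k%:R * binomial_moment z N k m +
    \sum_(b < N.+1) b%:R * ((k + b)%:R ^+ m * (z ^+ b * (1 - z) ^+ (N - b)) *+
      'C(N, b)).
  rewrite mulr_sumr -big_split /=; apply: eq_bigr => b _.
  rewrite exprS; set X := _ ^+ m; set W := z ^+ b * _.
  by rewrite natrD -!mulrA mulrDl mulrnDl !mulrnAr.
congr (_ + _); rewrite big_ord_recl /= mul0r add0r.
case: N => [|N]; first by rewrite big_ord0 !mul0r.
rewrite mulr_sumr; apply: eq_bigr => b _; rewrite /bump leq0n add1n addSnnS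
  subSS /=.
have := mul_bin_diag N.+1 b => /= /(congr1 (fun j : nat => j%:R : R)).
rewrite !natrM => e.
rewrite -[X in _ * X = _]mulr_natr -[X in _ = _ * X]mulr_natr exprS.
set X := _ ^+ m; set W := (1 - z) ^+ _.
move: e; set u := 'C(N, b)%:R; set v := 'C(N.+1, b.+1)%:R.
by move: X W u v b.+1%:R N.+1%:R (z ^+ b) => X W u v B M y e; ring: e.
Qed.

(* Generalising to the shifted variable k + Bin(P - k, z), whose mean is
   P z + k (1 - z), makes the induction on m go through. *)
Lemma binomial_moment_le (R : realType) (z : R) P k m : 0 <= z <= 1 -> (k <= P)%N ->
  binomial_moment z (P - k) k m <= (P%:R * z + (k + m)%:R * (1 - z)) ^+ m.
Proof.
move=> z01; have /andP[z0 z1] := z01.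
elim: m k => [|m IH] k kP; first by rewrite binomial_moment0 expr0.
set w := P%:R * z + (k + m.+1)%:R * (1 - z).
have w0 : 0 <= w by rewrite addr_ge0 ?mulr_ge0 ?subr_ge0.
(* The recursion calls the shifts [k] and k + 1; either one gives a base at most [w]. *)
have step j : (j <= k.+1)%N -> (j <= P)%N -> binomial_moment z (P - j) j m <= w
  ^+ m.
  move=> jk jP; apply: (le_trans (IH _ jP)); apply: lerXn2r; rewrite ?nnegrE //.
    by rewrite addr_ge0 ?mulr_ge0 ?subr_ge0.
  by rewrite lerD2l ler_wpM2r ?subr_ge0 // ler_nat; lia.
rewrite binomial_momentS exprS.
apply: (@le_trans _ _ ((k%:R + (P - k)%:R * z) * w ^+ m)).
  rewrite mulrDl lerD //; first by rewrite ler_wpM2l // step //.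
  have [e|e] := leqP P k; first by rewrite (_ : P - k = 0)%N ?mul0r //; lia.
  by rewrite ler_wpM2l ?mulr_ge0 // -subnS step.
(* What remains is that the mean P z + k (1 - z) of the shifted variable is at most [w]. *)
rewrite ler_wpM2r ?exprn_ge0 //.
rewrite natrB // /w natrD.
have : 0 <= m.+1%:R :> R by [].
by move: m.+1%:R => M M0; nra.
Qed.

(** * Two bounds on the probability that a set of nodes is separated *)

Section SeparatedBounds.
Variables (R : realType) (n K P : nat).
Hypotheses (K0 : (0 < K)%N) (KP : (K <= P)%N).
Local Notation ring_pmf := (@uniform_pmf R _ (key_rings K P)).
Local Notation mean := (@iid_mean R n _ ring_pmf).
Local Notation subset_prob := (subset_prob R K P).
Implicit Types (S : {set 'I_n}) (Z : {set 'I_P}) (k : {ffun 'I_n -> {set 'I_P}}).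
Let pge0 := @ring_pmf_ge0 R K P.
Let psum1 := ring_pmf_sum1 R KP.

Let P_gt0 : (0 < P%:R :> R).
Proof. by rewrite ltr0n (leq_trans K0). Qed.

(** Decay per key of the union: n - r rings avoid u keys with probability at most (1 - u / P)^(K (n
    - r)), which is at most exp of - u times this rate. *)
Definition avoid_rate (r : nat) : R := K%:R * (n%:R - r%:R) / P%:R.

Lemma card_set_ord_le (m : nat) (A : {set 'I_m}) : (#|A| <= m)%N.
Proof. by have := max_card A; rewrite card_ord. Qed.

Lemma mean_separated_le S :
  mean (fun k => (separated S k)%:R) <=
  mean (fun k => expR (- avoid_rate #|S|) ^+ #|ring_union S k|).
Proof.
have Sn : (#|S| <= n)%N := card_set_ord_le S.
have -> : mean (fun k => (separated S k)%:R) =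
          mean (fun k => 1 * (separated S k)%:R).
  by apply: eq_iid_mean => // k _; rewrite mul1r.
rewrite (mean_separated KP S (fun=> 1)); apply: ler_iid_mean => // k _;
  rewrite mul1r.
set u := #|ring_union S k|.
have uP : (u <= P)%N := card_set_ord_le _.
have h : subset_prob (P - u) <= expR (- (u%:R / P%:R)) ^+ K.
  apply: (le_trans (subset_prob_le_exp R KP (leq_subr _ _))).
  apply: lerXn2r; rewrite ?nnegrE ?divr_ge0 ?expR_ge0 //.
  apply: le_trans (expR_ge1Dx _).
  by rewrite natrB // mulrBl divff ?gt_eqF.
apply: (@le_trans _ _ ((expR (- (u%:R / P%:R)) ^+ K) ^+ (n - #|S|))).
  by apply: lerXn2r => //; rewrite nnegrE ?subset_prob_ge0 ?exprn_ge0 ?expR_ge0.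
rewrite -!expRM_natl ler_expR /avoid_rate natrB //.
by rewrite le_eqVlt; apply/orP; left; apply/eqP; field; rewrite gt_eqF.
Qed.

Lemma mean_ring_union_subset_le S Z :
  mean (fun k => (ring_union S k \subset Z)%:R) <=
  (#|Z|%:R / P%:R) ^+ (K * #|S|).
Proof.
rewrite mean_ring_union_subset // exprM; apply: lerXn2r.
- by rewrite nnegrE subset_prob_ge0.
- by rewrite nnegrE exprn_ge0 ?divr_ge0.
- by apply: subset_prob_le_exp => //; apply: card_set_ord_le.
Qed.

(** The mixture over [Z] becomes a binomial moment of order K |S| with shift 0, divided by P^(K
    |S|). *)
Lemma mean_separated_le_small S (z := expR (- avoid_rate #|S|)) :
  mean (fun k => (separated S k)%:R) <=
  (z + (#|S|%:R * K%:R / P%:R) * (1 - z)) ^+ (K * #|S|).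
Proof.
apply: (le_trans (mean_separated_le S)); rewrite -/z.
have z0 : 0 <= z by apply: expR_ge0.
have z1 : z <= 1.
  rewrite -expR0 ler_expR oppr_le0 divr_ge0 // mulr_ge0 // subr_ge0 ler_nat.
  exact: card_set_ord_le.
set m := (K * #|S|)%N.
rewrite mean_expr_ring_union //.
pose F (b : nat) := b%:R ^+ m * (z ^+ b * (1 - z) ^+ (P - b)) / P%:R ^+ m.
apply: (@le_trans _ _ (\sum_(Z : {set 'I_P}) F #|Z|)).
  apply: ler_sum => Z _; rewrite /F [leRHS]mulrAC -expr_div_n [leLHS]mulrC
    ler_wpM2r //.
    by rewrite mulr_ge0 ?exprn_ge0 ?subr_ge0.
  by rewrite -mean_ring_union_subset //; apply: mean_ring_union_subset_le.
rewrite sum_set_card card_ord.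
have -> : \sum_(b < P.+1) F b *+ 'C(P, b) = binomial_moment z P 0 m / P%:R ^+ m.
  by rewrite mulr_suml; apply: eq_bigr => b _; rewrite add0n mulrnAl.
have := @binomial_moment_le R z P 0 m; rewrite subn0 z0 z1 => /(_ isT isT) h.
rewrite ler_pdivrMr ?exprn_gt0 // -exprMn; apply: (le_trans h).
rewrite le_eqVlt; apply/orP; left; apply/eqP; congr (_ ^+ _).
by rewrite add0n /m natrM; field; rewrite gt_eqF.
Qed.

Lemma sum_expr_card (c : R) : \sum_(Z : {set 'I_P}) c ^+ #|Z| = (1 + c) ^+ P.
Proof.
rewrite (sum_set_card _ (fun b => c ^+ b)) card_ord exprDn.
by apply: eq_bigr => b _; rewrite expr1n mul1r.
Qed.

(** The cut is at |U| = c P for the union U of the rings. The first term is the cost of avoiding a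
    larger union, the second a union bound over the sets [Z] of at most c P keys that may contain a
    smaller one. *)
Lemma mean_separated_le_large S (g : R) (c := expR (- g)) : 0 <= g ->
  mean (fun k => (separated S k)%:R) <=
  expR (- (c * K%:R * (n%:R - #|S|%:R))) +
  expR (- (g * (K * #|S|)%:R) + g * (c * P%:R) + c * P%:R).
Proof.
move=> g0; set m := (K * #|S|)%N.
apply: (le_trans (mean_separated_le S)).
have c0 : 0 < c by apply: expR_gt0.
have Sn : #|S|%:R <= n%:R :> R by rewrite ler_nat card_set_ord_le.
apply: (@le_trans _ _ (mean (fun k => expR (- (c * K%:R * (n%:R - #|S|%:R))) +
   \sum_(Z : {set 'I_P} | #|Z|%:R <= c * P%:R) (ring_union S k \subset Z)%:R))).
  apply: ler_iid_mean => // k _; set U := ring_union S k.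
  have [small|large] := leP (#|U|%:R : R) (c * P%:R).
    rewrite (bigD1 U) //= subxx.
    apply: (@le_trans _ _ 1).
      rewrite -expRM_natl -expR0 ler_expR mulrN oppr_le0 mulr_ge0 // divr_ge0 //.
      by rewrite mulr_ge0 // subr_ge0.
    rewrite addrCA lerDl addr_ge0 ?expR_ge0 //.
    by apply: sumr_ge0.
  rewrite -[leLHS]addr0 lerD //; last by apply: sumr_ge0.
  rewrite -expRM_natl ler_expR mulrN lerN2 /avoid_rate.
  rewrite (_ : _ * _ * _ = c * P%:R * (K%:R * (n%:R - #|S|%:R) / P%:R)); last first.
    by field; rewrite gt_eqF.
  apply: ler_wpM2r (ltW large).
  by rewrite divr_ge0 ?mulr_ge0 ?subr_ge0.
rewrite iid_meanD iid_mean_const // lerD2l iid_mean_sum.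
(* On the sets kept, exp (g (c P - |Z|)) >= 1. With this factor inserted, c^|Z| can be summed over
   all [Z], giving (1 + c)^P <= exp (c P). *)
apply: (@le_trans _ _ (\sum_(Z : {set 'I_P} | #|Z|%:R <= c * P%:R)
    expR (- (g * m%:R) + g * (c * P%:R)) * c ^+ #|Z|)).
  apply: ler_sum => Z Zc; apply: (le_trans (mean_ring_union_subset_le _ _)).
  rewrite -/m -expRM_natl -expRD.
  apply: (@le_trans _ _ (c ^+ m)).
    by apply: lerXn2r; rewrite ?nnegrE ?divr_ge0 ?expR_ge0 ?ler_pdivrMr.
  rewrite -expRM_natl ler_expR.
  have : g * #|Z|%:R <= g * (c * P%:R) by rewrite ler_wpM2l.
  by rewrite !mulrN (mulrC m%:R) (mulrC #|Z|%:R); lra.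
rewrite -mulr_sumr [leRHS]expRD ler_wpM2l ?expR_ge0 //.
apply: (@le_trans _ _ (\sum_(Z : {set 'I_P}) c ^+ #|Z|)).
  rewrite [leLHS]big_mkcond; apply: ler_sum => Z _; case: ifP => // _.
  by rewrite exprn_ge0 ?expR_ge0.
rewrite sum_expr_card [c * _]mulrC expRM_natl; apply: lerXn2r;
  rewrite ?nnegrE ?expR_ge0 //.
  by rewrite addr_ge0 ?expR_ge0.
exact: expR_ge1Dx.
Qed.

End SeparatedBounds.

(** * Disconnection and separated sets *)

Section KeyGraph.
Variables (n P : nat).
Implicit Types (S : {set 'I_n}) (k : {ffun 'I_n -> {set 'I_P}}).

Lemma separatedP S k :
  reflect (forall i j, i \in S -> j \notin S -> k i :&: k j = finset.set0)
          (separated S k).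
Proof.
apply: (iffP forallP) => [sep i j iS jS | sep j].
  apply/eqP; rewrite finset.setI_eq0 finset.disjoints_subset.
  have := implyP (sep j) jS; rewrite -finset.disjoints_subset disjoint_sym
    finset.disjoints_subset.
  by move/finset.bigcupsP; apply.
apply/implyP => jS; rewrite -finset.disjoints_subset disjoint_sym
  finset.disjoints_subset.
apply/finset.bigcupsP => i iS; rewrite -finset.disjoints_subset -finset.setI_eq0.
by rewrite sep.
Qed.

Lemma key_graph_sym k : symmetric (key_graph k).
Proof. by move=> i j; rewrite /key_graph eq_sym finset.setIC. Qed.

Lemma key_graph_connect_sym k : connect_sym (key_graph k).
Proof. exact: sym_connect_sym (key_graph_sym k). Qed.

Lemma separated_closed S k : separated S k -> fingraph.closed (key_graph k) S.
Proof.
move=> /separatedP sep; apply: intro_closed; first exact: key_graph_connect_sym.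
move=> i j /andP[_ kij] iS; apply: contraT => jS.
by rewrite sep ?eqxx in kij.
Qed.

Lemma separatedC S k : separated S k -> separated (~: S) k.
Proof.
move=> /separatedP sep; apply/separatedP => i j.
by rewrite !inE negbK => iS jS; rewrite finset.setIC sep.
Qed.

Lemma connected_separated S k i j :
  connected_graph (key_graph k) -> separated S k -> (i \in S) = (j \in S).
Proof.
move=> /forallP/(_ i)/forallP/(_ j) cij /separated_closed clS.
exact: (closed_connect clS cij).
Qed.

(** The set is the component of [i] or its complement, which contains [j], whichever has at most
    half of the nodes. *)
Lemma disconnected_separated k : ~~ connected_graph (key_graph k) ->
  exists S, [/\ (0 < #|S|)%N, (2 * #|S| <= n)%N & separated S k].
Proof.
rewrite negb_forall => /existsP[i]; rewrite negb_forall => /existsP[j nij].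
pose C : {set 'I_n} := [set x | connect (key_graph k) i x]%SET.
have sepC : separated C k.
  apply/separatedP => x y; rewrite !inE => ix; apply: contraNeq => kxy.
  have [<-//|xy] := eqVneq x y.
  by apply: connect_trans ix _; apply: connect1; rewrite /key_graph xy.
have [le|gt] := leqP (2 * #|C|) n.
  exists C; split=> //; apply/card_gt0P; exists i; by rewrite inE connect0.
exists (~: C); split; last exact: separatedC.
- by apply/card_gt0P; exists j; rewrite !inE.
- by have := cardsC C; rewrite card_ord; lia.
Qed.

End KeyGraph.

(** * Connectivity through first and second moments *)

Section ConnectivityBounds.
Variables (R : realType) (n K P : nat).
Hypotheses (K0 : (0 < K)%N) (KP : (K <= P)%N).
Local Notation ring_pmf := (@uniform_pmf R _ (key_rings K P)).
Local Notation mean := (@iid_mean R n _ ring_pmf).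
Local Notation subset_prob := (subset_prob R K P).
Implicit Types (S : {set 'I_n}) (Z : {set 'I_P}) (k : {ffun 'I_n -> {set 'I_P}}).
Let pge0 := @ring_pmf_ge0 R K P.
Let psum1 := ring_pmf_sum1 R KP.

Lemma prob_connected_le1 : prob_connected R n K P <= 1.
Proof.
rewrite /prob_connected iid_probE -[leRHS](iid_mean_const n psum1).
by apply: ler_iid_mean => // k _; rewrite lern1 leq_b1.
Qed.

Lemma prob_connected_ge0 : 0 <= prob_connected R n K P.
Proof. by apply: sumr_ge0 => k _; apply: prodr_ge0. Qed.

(** Union bound over the nonempty separated sets of at most n / 2 nodes, grouped by size. *)
Lemma prob_disconnected_le (B : nat -> R) :
  (forall S, (0 < #|S|)%N -> (2 * #|S| <= n)%N ->
     mean (fun k => (separated S k)%:R) <= B #|S|) ->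
  1 - prob_connected R n K P <=
  \sum_(r < n.+1 | (0 < r)%N && (2 * r <= n)%N) 'C(n, r)%:R * B r.
Proof.
move=> hB; rewrite /prob_connected iid_probE.
pose good S := (0 < #|S|)%N && (2 * #|S| <= n)%N.
have -> : 1 - mean (fun k => (connected_graph (key_graph k))%:R) =
    mean (fun k => (~~ connected_graph (key_graph k))%:R).
  apply/eqP; rewrite subr_eq -iid_meanD; apply/eqP.
  rewrite -[LHS](iid_mean_const n psum1); apply: eq_iid_mean => // k _.
  by case: connected_graph; rewrite ?add0r ?addr0.
apply: (@le_trans _ _ (\sum_(S | good S) mean (fun k => (separated S k)%:R))).
  rewrite -iid_mean_sum; apply: ler_iid_mean => // k _.
  have [cg|/disconnected_separated[S [S0 Sn sepS]]] := boolP (connected_graph _).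
    by apply: sumr_ge0.
  by rewrite (bigD1 S) /= /good ?S0 ?Sn // sepS lerDl sumr_ge0.
pose F (r : nat) := if (0 < r)%N && (2 * r <= n)%N then B r else 0.
apply: (@le_trans _ _ (\sum_(S : {set 'I_n}) F #|S|)).
  rewrite [leLHS]big_mkcond; apply: ler_sum => S _.
  by rewrite /F /good; case: ifP => // /andP[S0 Sn]; apply: hB.
rewrite sum_set_card card_ord [leRHS]big_mkcond; apply: ler_sum => r _.
by rewrite /F; case: ifP => _; rewrite ?mul0rn ?mulr_natl.
Qed.

Lemma mean_isolated (a : 'I_n) :
  mean (fun k => (separated [set a]%SET k)%:R) = subset_prob (P - K) ^+ n.-1.
Proof.
rewrite -[RHS](iid_mean_const n psum1).
transitivity (mean (fun k => 1 * (separated [set a]%SET k)%:R)).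
  by apply: eq_iid_mean => // k _; rewrite mul1r.
rewrite (mean_separated KP _ (fun=> 1)); apply: eq_iid_mean => // k pk.
by rewrite mul1r /ring_union big_set1 (ring_pmf_gt0 (pk a)) cards1 subn1.
Qed.

(** If both nodes are isolated, their rings are disjoint, so the union has exactly 2K keys, and the
    n - 2 other rings must avoid it. *)
Lemma mean_isolated2 (a b : 'I_n) : a != b ->
  mean (fun k => (separated [set a]%SET k)%:R * (separated [set b]%SET k)%:R) <=
  subset_prob (P - K) ^+ (2 * (n - 2)).
Proof.
move=> ab; set S := ([set a; b])%SET.
have cS : #|S| = 2%N by rewrite cards2 ab.
pose f (U : {set 'I_P}) : R := (#|U| == K + K)%N%:R.
apply: (@le_trans _ _ (mean (fun k => f (ring_union S k) * (separated S k)%:R))).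
  apply: ler_iid_mean => // k pk; rewrite /f.
  have [/separatedP sa|] := boolP (separated [set a]%SET k);
    last by rewrite mul0r mulr_ge0.
  have [/separatedP sb|] := boolP (separated [set b]%SET k);
    last by rewrite mulr0 mulr_ge0.
  have -> : #|ring_union S k| = (K + K)%N.
    rewrite /ring_union big_setU1 /= ?inE // big_set1 cardsU.
    by rewrite (ring_pmf_gt0 (pk a)) (ring_pmf_gt0 (pk b)) sa ?inE ?eqxx //
      1?eq_sym // cards0 subn0.
  have -> // : separated S k; last by rewrite eqxx.
  apply/separatedP => i j; rewrite !inE negb_or => /orP[]/eqP -> /andP[ja jb].
    by apply: sa; rewrite inE.
  by apply: sb; rewrite inE.
rewrite (mean_separated KP) cS -[leRHS](iid_mean_const n psum1).
apply: ler_iid_mean => // k _; rewrite /f; case: eqP => [->|_];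
  last by rewrite mul0r exprn_ge0 ?subset_prob_ge0.
rewrite mul1r exprM; apply: lerXn2r; rewrite ?nnegrE ?exprn_ge0 ?subset_prob_ge0 //.
by rewrite subnDA subset_prob_sqr.
Qed.

(* Chebyshev: when the graph is connected there is no isolated node, and then
   (1 - I / m)^2 = 1 for the number I of isolated nodes and its mean m. *)
Lemma prob_connected_second_moment (q := subset_prob (P - K)) : (1 < n)%N -> 0 <
  q ->
  prob_connected R n K P <= (n%:R * q ^+ n.-1)^-1 + q ^- 2 - 1.
Proof.
move=> n1 q0; rewrite /prob_connected iid_probE.
pose iso (a : 'I_n) k : R := (separated [set a]%SET k)%:R.
pose I k := \sum_a iso a k.
pose mu := n%:R * q ^+ n.-1.
have n0 : 0 < n%:R :> R by rewrite ltr0n ltnW.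
have mu0 : 0 < mu by rewrite mulr_gt0 ?exprn_gt0.
have EI : mean I = mu.
  rewrite iid_mean_sum (eq_bigr (fun=> q ^+ n.-1)) => [|a _];
    last exact: mean_isolated.
  by rewrite sumr_const card_ord -mulr_natl.
have EI2 : mean (fun k => \sum_a \sum_b iso a k * iso b k) <=
    mu + n%:R ^+ 2 * q ^+ (2 * (n - 2)).
  rewrite iid_mean_sum.
  under eq_bigr do rewrite iid_mean_sum.
  (* A diagonal term is [iso a] itself, of mean q^(n - 1); adding the off-diagonal bound there too
     only enlarges the sum. *)
  apply: (@le_trans _ _ (\sum_(a < n) \sum_(b < n)
     ((if b == a then q ^+ n.-1 else 0) + q ^+ (2 * (n - 2))))).
    apply: ler_sum => a _; apply: ler_sum => b _.
    have [->|ba] := eqVneq b a; last by rewrite add0r mean_isolated2 // eq_sym.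
    rewrite -(mean_isolated a) -[leLHS]addr0 lerD ?exprn_ge0 ?subset_prob_ge0 //.
    by apply: ler_iid_mean => // k _; rewrite /iso; case: separated;
      rewrite ?mulr1 ?mulr0.
  under eq_bigr do rewrite big_split /= -big_mkcond big_pred1_eq sumr_const
    card_ord.
  rewrite big_split /= !sumr_const card_ord -mulrnA.
  by rewrite -[X in X + _ <= _]mulr_natl -[X in _ + X <= _]mulr_natl natrM -expr2.
apply: (@le_trans _ _ (mean (fun k => 1 + (- (2 / mu) * I k +
    mu ^- 2 * \sum_a \sum_b iso a k * iso b k)))).
  apply: ler_iid_mean => // k _.
  have -> : \sum_a \sum_b iso a k * iso b k = I k ^+ 2.
    by rewrite expr2 mulr_suml; apply: eq_bigr => a _; rewrite mulr_sumr.
  have -> : 1 + (- (2 / mu) * I k + mu ^- 2 * I k ^+ 2) = (1 - I k / mu) ^+ 2.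
    by field; rewrite gt_eqF.
  have [cg|_] := boolP (connected_graph _); last exact: sqr_ge0.
  have -> : I k = 0; last by rewrite mul0r subr0 expr1n.
  rewrite /I big1 // => a _; rewrite /iso; case: (boolP (separated _ _)) => // sa.
  have [b ba] : exists b : 'I_n, b != a.
    have : (0 < #|[set~ a]|)%N by rewrite cardsC1 card_ord; lia.
    by case/card_gt0P => b; rewrite !inE => ba; exists b.
  have := connected_separated a b cg sa.
  by rewrite !inE eqxx (negbTE ba).
rewrite iid_meanD iid_mean_const // iid_meanD !iid_meanZ EI.
apply: (@le_trans _ _ (1 + (- (2 / mu) * mu +
    mu ^- 2 * (mu + n%:R ^+ 2 * q ^+ (2 * (n - 2)))))).
  by rewrite !lerD2l ler_wpM2l // invr_ge0 exprn_ge0 // ltW.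
rewrite le_eqVlt; apply/orP; left; apply/eqP.
(* As 2 (n - 2) = 2 (n - 1) - 2, the pair term is mu^2 up to the factor q^-2. *)
have -> : n%:R ^+ 2 * q ^+ (2 * (n - 2)) = mu ^+ 2 * q ^- 2.
  rewrite /mu; move: (q) q0 => y y0.
  have e : y ^+ (2 * (n - 2)) * y ^+ 2 = y ^+ n.-1 ^+ 2.
    by rewrite -exprD -exprM; congr (_ ^+ _); lia.
  by rewrite exprMn -e mulrA mulfK // expf_neq0 ?gt_eqF.
rewrite -/mu; move: (mu) (q) mu0 q0 => m y m0 y0.
by field; rewrite !gt_eqF.
Qed.

End ConnectivityBounds.

(** * Real estimates for the exponents *)

Section RealEstimates.
Variable R : realType.
Implicit Types (N r k p s x y w sigma : R).

(** A single term of the expansion of (1 + y)^n, which is at most exp (n y). *)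
Lemma bin_mul_exp_le_expR (n r : nat) y : (r <= n)%N -> 0 <= y ->
  'C(n, r)%:R * y ^+ r <= expR (n%:R * y).
Proof.
move=> rn y0; apply: (@le_trans _ _ ((1 + y) ^+ n)); last first.
  by rewrite expRM_natl; apply: lerXn2r; rewrite ?nnegrE ?expR_ge0 ?addr_ge0
    ?expR_ge1Dx.
have rn1 : (r < n.+1)%N by [].
rewrite exprDn (bigD1 (Ordinal rn1)) //= expr1n mul1r mulr_natl lerDl.
by apply: sumr_ge0 => i _; rewrite expr1n mul1r mulrn_wge0 ?exprn_ge0.
Qed.

Lemma bin_le_expR (n r : nat) : (r <= n)%N -> 'C(n, r)%:R <= expR (n%:R : R).
Proof.
by move=> rn; have := bin_mul_exp_le_expR rn ler01; rewrite expr1n !mulr1.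
Qed.

(** The bound 'C(n, r) <= (e n / r)^r, obtained from y = r / n in [bin_mul_exp_le_expR]. *)
Lemma bin_le_expR_ln (n r : nat) : (0 < r)%N -> (r <= n)%N ->
  'C(n, r)%:R <= expR (r%:R * (1 + ln n%:R - ln r%:R) : R).
Proof.
move=> r0 rn; have n0 := leq_trans r0 rn.
have rR : (0 : R) < r%:R by rewrite ltr0n.
have nR : (0 : R) < n%:R by rewrite ltr0n.
have y0 : (0 : R) < r%:R / n%:R by rewrite divr_gt0.
have := bin_mul_exp_le_expR rn (ltW y0).
rewrite (_ : n%:R * _ = r%:R); last by field; rewrite gt_eqF.
rewrite -ler_pdivlMr ?exprn_gt0 // => h; apply: (le_trans h).
rewrite -{1}(lnK (x := r%:R / n%:R)) ?posrE // -expRM_natl -expRN -expRD ler_expR.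
by rewrite ln_div ?posrE //; lra.
Qed.

Lemma ln2_le1 : ln (2 : R) <= 1.
Proof. by have := @le_ln1Dx R 1; rewrite (_ : 1 + 1 = 2) //; apply; lra. Qed.

(** Convexity of exp: the chord from 0 has increasing slope. It follows from 1 + x <= exp x at t - s
    and at - s, combined with weights [s] and t - s. *)
Lemma expR_chord s t : 0 <= s <= t -> t * (expR s - 1) <= s * (expR t - 1).
Proof.
move=> /andP[s0 st].
have e1 : expR s * (1 + (t - s)) <= expR t.
  by rewrite -{2}(subrKC s t) expRD ler_wpM2l ?expR_ge0 ?expR_ge1Dx.
have e2 : expR s * (1 - s) <= 1.
  rewrite -[leRHS](expRxMexpNx_1 s) ler_wpM2l ?expR_ge0 //.
  by have := expR_ge1Dx (- s).
have e3 : s * (expR s * (1 + (t - s))) <= s * expR t by rewrite ler_wpM2l.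
have e4 : (t - s) * (expR s * (1 - s)) <= (t - s) * 1 by rewrite ler_wpM2l
  ?subr_ge0.
move: e3 e4; move: (expR s) (expR t) => a b; nra.
Qed.

(** Here N, r, k, p stand for n, |S|, K, P, and exp (- w r) is the target. Saturation bounds 10 c p
    by 5 k r, leaving - 4 k r; with sigma N <= p it also bounds ln (N / r) by ln k plus a constant,
    so the linear term in k wins. *)
Lemma saturated_exponent_subset N r k p sigma w : 1 <= r -> 2 * r <= N -> 1 <= k ->
  0 < p -> 0 < sigma -> sigma * N <= p -> 2 * (expR (- 9) * p) <= r * k ->
  10 - ln sigma + w <= 3 * k ->
  r * (1 + ln N - ln r) + (- (9 * (k * r)) + 9 * (expR (- 9) * p) + expR (- 9) * p)
  <= - (w * r).
Proof.
move=> r1 rN k1 p0 s0 sN sat kw; set c := expR (- 9) in sat *.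
have c0 : 0 < c := expR_gt0 _.
have N0 : 0 < N by lra.
have r0 : 0 < r by lra.
have k0 : 0 < k by lra.
have h : ln (2 * c * (sigma * N)) <= ln (r * k).
  rewrite ler_ln ?posrE ?mulr_gt0 //; apply: le_trans sat.
  by rewrite -mulrA ler_wpM2l // ler_wpM2l // ltW.
have lk : ln k <= k - 1.
  by have := @le_ln1Dx R (k - 1); rewrite subrKC; apply; lra.
move: h; rewrite !lnM ?posrE ?mulr_gt0 // expRK => h.
have l2 : 0 <= ln (2 : R) by rewrite ln_ge0 //; lra.
have e : 1 + ln N - ln r - 4 * k <= - w by lra.
have : r * (1 + ln N - ln r - 4 * k) <= r * - w by rewrite ler_wpM2l // ltW.
by move: sat; lra.
Qed.

(** Since N - r >= N / 2, the subtracted term is at least (1 + w) N, which beats the bound exp N on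
    the binomial coefficient. *)
Lemma saturated_exponent_avoid N r k w : 0 <= w -> 1 <= r -> 2 * r <= N ->
  2 * (1 + w) <= expR (- 9) * k ->
  N - expR (- 9) * k * (N - r) <= - (w * r).
Proof. move=> w0 r1 rN; move: (expR (- 9) * k) => ck h; nra. Qed.

Section Unsaturated.
Variables (N r k p sigma w : R).
Hypotheses (r1 : 1 <= r) (rN : 2 * r <= N) (k1 : 1 <= k) (p0 : 0 < p).
Hypotheses (s0 : 0 < sigma) (sN : sigma * N <= p) (w0 : 0 <= w).
Let d := r * k / p.
Hypothesis d_small : d <= 2 * expR (- 9).

Let N0 : 0 < N. Proof. by have := r1; have := rN; lra. Qed.
Let r0 : 0 < r. Proof. by have := r1; lra. Qed.
Let k0 : 0 < k. Proof. by have := k1; lra. Qed.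
Let d0 : 0 < d. Proof. by rewrite divr_gt0 ?mulr_gt0. Qed.

Let lnd : ln d = ln r + ln k - ln p.
Proof. by rewrite ln_div ?posrE ?mulr_gt0 // lnM ?posrE. Qed.

Let lnd_le : ln d <= - 8.
Proof.
apply: (@le_trans _ _ (ln (2 * expR (- 9)))); first by rewrite ler_ln ?posrE ?d0
  // mulr_gt0 ?expR_gt0.
by rewrite lnM ?posrE ?expR_gt0 // expRK; have := ln2_le1; lra.
Qed.

Let lnp_ge : ln sigma + ln N <= ln p.
Proof. by rewrite -lnM ?posrE // ler_ln ?posrE ?mulr_gt0. Qed.

(** This serves the case z <= d, where the base of the moment bound is at most 2d. One factor d
    cancels N / r, because p >= sigma N; the other k - 1 factors, each at most exp (- 8), pay for
    the rest. *)
Lemma unsaturated_exponent_overlap : 9 - ln sigma + w <= 6 * k ->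
  r * (1 + ln N - ln r) + k * r * ln (2 * d) <= - (w * r).
Proof.
move=> kw; rewrite lnM ?posrE //.
have hk := k1; have hd := lnd_le.
have lk : ln k <= k - 1.
  by have := @le_ln1Dx R (k - 1); rewrite subrKC; apply; lra.
have e : 1 + ln N - ln r + k * (ln 2 + ln d) <= - w.
  have : (k - 1) * ln d <= (k - 1) * (- 8) by rewrite ler_wpM2l //; lra.
  have : k * ln 2 <= k * 1 :> R by rewrite ler_wpM2l ?ln2_le1 //; lra.
  move: (lnd) (lnp_ge); move: (ln d) (ln 2 : R) => ld l2; nra.
have : r * (1 + ln N - ln r + k * (ln 2 + ln d)) <= r * - w by rewrite ler_wpM2l
  // ltW.
by lra.
Qed.

(** The leading terms ln N in x and in the binomial bound cancel. The losses rho = r / N and li = -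
    1 / ln d are absorbed by ln r when r is large, and by the constant gained from x - ln N when r
    is small. *)
Lemma unsaturated_exponent_main (x := N * k ^+ 2 / p) :
  16 * (5 + w) <= ln N -> 3 * (6 - ln sigma) <= ln N ->
  4 * (5 + w) <= x - ln N ->
  r * (1 + ln N - ln r) - r * (x * (1 - r / N) * (1 + (ln d)^-1)) <= - (w * r).
Proof.
move=> a1 a2 ax; have hw := w0; have hr := r1; have hN := rN; have hd := lnd_le.
set a := ln N in a1 a2 ax *; set b := ln r.
set rho := r / N; pose li := - (ln d)^-1.
have b0 : 0 <= b by rewrite ln_ge0.
have a0 : 0 < a by lra.
have rho0 : 0 < rho by rewrite divr_gt0.
have rho2 : rho <= 1 / 2 by rewrite ler_pdivrMr //; lra.
have li0 : 0 < li by rewrite oppr_gt0 invr_lt0; lra.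
have lid : li * - ln d = 1 by rewrite /li mulrNN mulVf // lt_eqF //; lra.
have li8 : li <= 1 / 8 by nra.
have -> : (ln d)^-1 = - li by rewrite /li opprK.
have x0 : 0 < x by lra.
suff e : 1 + a - b - x * (1 - rho) * (1 - li) <= - w.
  rewrite -mulrBr [w * r]mulrC -[leRHS]mulrN.
  by apply: ler_wpM2l e; apply: ltW.
have e1 : x * (1 - rho - li) <= x * (1 - rho) * (1 - li).
  by rewrite -mulrA ler_wpM2l ?ltW //; nra.
suff e : 1 + a - b - x * (1 - rho - li) <= - w by lra.
clear e1.
(* For x >= 8 ln N, the quarter of x that survives the losses is enough. *)
have [xa|xa] := leP (8 * a) x.
  have : x * (1 / 4) <= x * (1 - rho - li) by rewrite ler_wpM2l ?ltW //; lra.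
  by lra.
(* Otherwise the excess x - a >= 4 (5 + w) contributes at least 5 + w. *)
have e1 : (x - a) * (1 / 4) <= (x - a) * (1 - rho - li) by rewrite ler_wpM2l; lra.
suff e : 1 + w + rho * a + a * li <= b + 5 + w by nra.
have erho : expR (b - a) = rho by rewrite expRB !lnK.
(* For r <= N^(1/4), rho a is bounded, and x < 8 a keeps [k] so small that ln d <= - a / 2, whence a
   li <= 2. *)
have [ba|ba] := leP (4 * b) a.
  have rhoa : rho * a <= 4 / 3.
    have : rho * (1 + (a - b)) <= 1.
      have er : rho * expR (a - b) = 1.
        by rewrite -erho -expRD (_ : b - a + (a - b) = 0) ?expR0 //; ring.
      by rewrite -[leRHS]er; apply: ler_wpM2l (expR_ge1Dx _); apply: ltW.
    by nra.
  have lnx : ln x = a + 2 * ln k - ln p.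
    by rewrite ln_div ?posrE ?mulr_gt0 ?exprn_gt0 // lnM ?posrE ?exprn_gt0 //
      lnXn // mulr_natl.
  have : ln x <= a / 8 + 6.
    (* The bound 8 a is split as 2^6 (a / 8), so that its logarithm is at most 6 + a / 8. *)
    apply: (@le_trans _ _ (ln (2 ^+ 6 * (a / 8)))).
      have le64 : x <= 2 ^+ 6 * (a / 8) by lra.
      by rewrite ler_ln ?posrE ?x0 //; lra.
    rewrite lnM ?posrE ?exprn_gt0 ?divr_gt0 // lnXn //.
    have := ln2_le1; have := @ln_sublinear R (a / 8).
    by rewrite divr_gt0 // => /(_ isT); move: (ln 2 : R) => l2;
      rewrite -mulr_natl; lra.
  move=> lnx6.
  have : a / 2 <= - ln d by move: (lnd) (lnp_ge); rewrite -/a -/b; lra.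
  move=> ld2; have : a * li <= 2 by nra.
  by lra.
(* For larger r, a < 4 b gives a li <= b / 2. The term rho a is small if rho <= 1/16, and otherwise
   b > a - 4 ln 2. *)
have lia : a * li <= a * (1 / 8) by rewrite ler_wpM2l // ltW.
have [rho16|rho16] := leP rho (1 / 16).
  have : rho * a <= (1 / 16) * a by rewrite ler_wpM2r // ltW.
  by lra.
have hb : ln (2 ^- 4) < ln rho by rewrite ltr_ln ?posrE ?invr_gt0 ?exprn_gt0 //;
  lra.
move: hb; rewrite lnV ?posrE ?exprn_gt0 // lnXn // -{1}erho expRK => hb.
have := ln2_le1; have : rho * a <= (1 / 2) * a by rewrite ler_wpM2r // ltW.
by move: hb; move: (ln 2 : R) => l2; lra.
Qed.

End Unsaturated.
End RealEstimates.

(** * Bounds with explicit thresholds, and the limits *)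

Section Asymptotics.
Variable R : realType.
Implicit Types (n K P : nat) (sigma w eps : R).

(** The subtracted term lets the induction close, since 2 y y^(m + 1) <= y^(m + 1). *)
Lemma geometric_sum_le (y : R) m : 0 <= y -> 2 * y <= 1 ->
  \sum_(r < m.+1 | (0 < r)%N) y ^+ r <= 2 * y - 2 * y ^+ m.+1.
Proof.
move=> y0 y1; elim: m => [|m IH].
  by rewrite big_mkcond big_ord1 /= expr1 subrr.
rewrite big_mkcond big_ord_recr /= -big_mkcond /=.
have : y ^+ m.+1 * (2 * y) <= y ^+ m.+1 * 1 by rewrite ler_wpM2l ?exprn_ge0.
move: IH; rewrite [y ^+ m.+2]exprSr; move: (y ^+ m.+1) => u; lra.
Qed.

(** After factoring out exp (- s), the chord of exp over [0, - ln d] bounds d (exp s - 1) by - s /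
    ln d, as d exp (- ln d) = 1. *)
Lemma mixture_le_expR (s d : R) : 0 <= s -> 0 < d -> ln d <= - s -> ln d < 0 ->
  expR (- s) + d * (1 - expR (- s)) <= expR (- (s * (1 + (ln d)^-1))).
Proof.
move=> s0 d0 sd ld0; have L0 : 0 < - ln d by rewrite oppr_gt0.
have Ld : d * expR (- ln d) = 1 by rewrite expRN lnK ?posrE ?divff ?gt_eqF.
have chord : - ln d * (expR s - 1) <= s * (expR (- ln d) - 1).
  by apply: expR_chord; rewrite s0 /=; lra.
have e1 : d * (expR s - 1) <= - (s * (ln d)^-1).
  rewrite -mulrN -invrN ler_pdivlMr //.
  have := ler_wpM2l (ltW d0) chord; move: Ld; move: (expR s) (expR (- ln d)) (ln
    d) => a b c; nra.
have -> : expR (- s) + d * (1 - expR (- s)) = expR (- s) * (1 + d * (expR s - 1)).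
  have := expRxMexpNx_1 s; move: (expR s) (expR (- s)) => a b ab; ring: ab.
rewrite (_ : - (s * _) = - s + - (s * (ln d)^-1)); last by ring.
rewrite expRD ler_wpM2l ?expR_ge0 //; apply: (le_trans (expR_ge1Dx _)).
by rewrite ler_expR.
Qed.

Lemma avoid_rate_exponent (N r k p v : R) : N != 0 -> p != 0 ->
  k * r * - (k * (N - r) / p * (1 + v)) =
  - (r * (N * k ^+ 2 / p * (1 - r / N) * (1 + v))).
Proof. by move=> N0 p0; field; rewrite N0. Qed.

(** Division by 'C(n, |S|) turns the union bound over sets into a geometric series. Three cases: d >
    2 exp (- 9), where the cut with g = 9 is used and its two terms give the factor 2; then z <= d
    and z > d, with z = exp (- s). *)
Lemma mean_separated_le_geometric sigma w n K P (S : {set 'I_n}) :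
  0 < sigma -> 0 <= w -> (0 < K)%N -> (K <= P)%N ->
  (0 < #|S|)%N -> (2 * #|S| <= n)%N -> sigma * n%:R <= P%:R ->
  10 - ln sigma + w <= 3 * K%:R -> 2 * (1 + w) <= expR (- 9) * K%:R ->
  16 * (5 + w) <= ln n%:R -> 3 * (6 - ln sigma) <= ln n%:R ->
  4 * (5 + w) <= n%:R * (K%:R ^+ 2 / P%:R) - ln n%:R ->
  iid_mean (@uniform_pmf R _ (key_rings K P)) (fun k => (separated S k)%:R) <=
  2 * expR (- w) ^+ #|S| / 'C(n, #|S|)%:R.
Proof.
move=> s0 w0 K0 KP S0 Sn sN hk1 hk2 a1 a2 ax.
have Sn1 : (#|S| <= n)%N := card_set_ord_le S.
have C0 : 0 < 'C(n, #|S|)%:R :> R by rewrite ltr0n bin_gt0.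
rewrite ler_pdivlMr // -expRM_natl mulrN [#|S|%:R * w]mulrC.
have binn := bin_le_expR R Sn1; have binr := bin_le_expR_ln R S0 Sn1.
have p0 : 0 < P%:R :> R by rewrite ltr0n (leq_trans K0).
have r1 : 1 <= #|S|%:R :> R by rewrite ler1n.
have rN : 2 * #|S|%:R <= n%:R :> R by rewrite -natrM ler_nat.
have k1 : 1 <= K%:R :> R by rewrite ler1n.
pose d : R := #|S|%:R * K%:R / P%:R.
have d0 : 0 < d by rewrite divr_gt0 // mulr_gt0 // ltr0n.
have [dsmall|dlarge] := leP d (2 * expR (- 9)); last first.
  have sat : 2 * (expR (- 9) * P%:R) <= #|S|%:R * K%:R :> R.
    by rewrite mulrA -ler_pdivlMr // ltW.
  apply: (le_trans (ler_wpM2r (ltW C0) (mean_separated_le_large K0 KP S (_ : 0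
    <= 9)))).
    by [].
  rewrite mulrDl [leRHS]mulr_natl mulr2n lerD //.
    apply: (le_trans (ler_wpM2l (expR_ge0 _) binn)).
    rewrite -expRD ler_expR addrC; exact: saturated_exponent_avoid.
  apply: (le_trans (ler_wpM2l (expR_ge0 _) binr)).
  rewrite -expRD ler_expR addrC natrM.
  exact: (saturated_exponent_subset (sigma := sigma)).
have lnd : ln d < 0.
  rewrite ln_lt0 // d0 /=; apply: (le_lt_trans dsmall).
  rewrite expRN ltr_pdivrMr ?expR_gt0 // mul1r.
  by apply: lt_le_trans (expR_ge1Dx _); lra.
have small := mean_separated_le_small R K0 KP S; cbv zeta in small.
apply: (le_trans (ler_wpM2r (ltW C0) small)).
set s := avoid_rate R n K P #|S|; rewrite -/d.
have s_ge0 : 0 <= s by rewrite divr_ge0 ?mulr_ge0 // subr_ge0; lra.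
have base0 : 0 <= expR (- s) + d * (1 - expR (- s)).
  rewrite addr_ge0 ?expR_ge0 // mulr_ge0 ?(ltW d0) // subr_ge0.
  by rewrite -expR0 ler_expR oppr_le0.
suff h : (expR (- s) + d * (1 - expR (- s))) ^+ (K * #|S|) * 'C(n, #|S|)%:R <=
    expR (- (w * #|S|%:R)).
  by apply: (le_trans h); have := expR_ge0 (- (w * #|S|%:R)); lra.
have [zd|dz] := leP (expR (- s)) d.
  have base_le : expR (- s) + d * (1 - expR (- s)) <= expR (ln (2 * d)).
    have d20 : 0 < 2 * d by lra.
    rewrite lnK ?posrE //.
    by have := expR_ge0 (- s); move: zd; move: (expR (- s)) => z; nra.
  have := lerXn2r (K * #|S|) base0 (expR_ge0 _) base_le.
  rewrite -expRM_natl natrM => h.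
  apply: (le_trans (ler_pM _ _ h binr)); rewrite ?exprn_ge0 //.
  rewrite -expRD ler_expR addrC.
  apply: (@unsaturated_exponent_overlap _ _ _ _ _ sigma) => //; lra.
have sd : ln d <= - s by rewrite -(expRK (- s)) ler_ln ?posrE ?expR_gt0 // ltW.
have := lerXn2r (K * #|S|) base0 (expR_ge0 _) (mixture_le_expR s_ge0 d0 sd lnd).
rewrite -expRM_natl natrM => h.
apply: (le_trans (ler_pM _ _ h binr)); rewrite ?exprn_ge0 //.
rewrite -expRD ler_expR addrC.
have N0 : n%:R != 0 :> R by rewrite gt_eqF //; lra.
rewrite (avoid_rate_exponent _ _ _ N0 (lt0r_neq0 p0)).
apply: (@unsaturated_exponent_main _ _ _ _ _ sigma) => //.
by rewrite -mulrA.
Qed.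

Lemma near_ln_ge (A : R) : \forall n \near \oo%classic, A <= ln n%:R.
Proof.
near=> n; have : expR A <= n%:R by near: n; exact: nbhs_infty_ger.
by rewrite -{2}(expRK A) => h; rewrite ler_ln ?posrE ?expR_gt0 // (lt_le_trans
  (expR_gt0 A)).
Unshelve. all: by end_near.
Qed.

Lemma prob_connected_ge eps sigma : 0 < eps -> 0 < sigma ->
  exists A : R, forall n K P, (0 < K)%N -> (K <= P)%N -> sigma * n%:R <= P%:R ->
    A <= ln n%:R -> A <= n%:R * (K%:R ^+ 2 / P%:R) - ln n%:R ->
    1 - eps <= prob_connected R n K P.
Proof.
(* This [w] gives 4 exp (- w) <= eps for the sum of the series, and w >= 1 keeps its ratio at most
   1/2. *)
move=> e0 s0; pose w : R := 1 + `|ln (eps / 4)|.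
have w1 : 1 <= w by rewrite lerDl.
(* A lower bound on K sufficient for both conditions on K in the exponent estimates; [expR 9]
   offsets the factor exp (- 9). *)
pose k0 : R := 10 + `|ln sigma| + w + 2 * (1 + w) * expR 9.
exists (16 * (5 + w) + 3 * (6 + `|ln sigma|) + k0 ^+ 2 / sigma).
move=> n K P K0 KP sN hn hx; set x := n%:R * _ in hx.
have nls := normr_ge0 (ln sigma); have lsn := ler_norm (- ln sigma).
rewrite normrN in lsn.
have k0s : 0 <= k0 ^+ 2 / sigma by rewrite divr_ge0 ?sqr_ge0 // ltW.
have a1 : 16 * (5 + w) <= ln n%:R by lra.
have a2 : 3 * (6 - ln sigma) <= ln n%:R by lra.
have a3 : k0 ^+ 2 / sigma <= ln n%:R by lra.
have ax : 4 * (5 + w) <= x - ln n%:R by lra.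
have n0 : 0 < n%:R :> R.
  by rewrite lt_neqAle ler0n andbT; apply: contraTneq a1 => <-;
    rewrite ln0 // -ltNge; lra.
have p0 : 0 < P%:R :> R by rewrite ltr0n (leq_trans K0).
(* Since K^2 = x P / n >= sigma ln n, a pool of at least linear size forces K to grow. *)
have k2 : k0 ^+ 2 <= K%:R ^+ 2.
  rewrite ler_pdivrMr // in a3; apply: (le_trans a3).
  have -> : K%:R ^+ 2 = x * (P%:R / n%:R) :> R by rewrite /x; field;
    rewrite !gt_eqF.
  apply: ler_pM; [by lra|exact: ltW|by lra|].
  by rewrite ler_pdivlMr.
have e9 : 0 <= 2 * (1 + w) * expR 9 by rewrite mulr_ge0 ?expR_ge0 //; lra.
have k0K : k0 <= K%:R by rewrite -ler_sqr ?nnegrE //; rewrite /k0; lra.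
have hk1 : 10 - ln sigma + w <= 3 * K%:R by move: k0K; rewrite /k0; lra.
have hk2 : 2 * (1 + w) <= expR (- 9) * K%:R.
  rewrite expRN [leRHS]mulrC ler_pdivlMr ?expR_gt0 //; apply: le_trans k0K.
  by rewrite /k0; lra.
have w0 : 0 <= w by lra.
have := @prob_disconnected_le R n K P KP (fun r => 2 * expR (- w) ^+ r / 'C(n,
  r)%:R).
move=> /(_ (fun S S0 Sn => mean_separated_le_geometric s0 w0 K0 KP S0 Sn sN hk1
  hk2 a1 a2 ax)).
move=> hd.
suff : 1 - prob_connected R n K P <= eps by lra.
apply: (le_trans hd).
apply: (@le_trans _ _ (2 * \sum_(r < n.+1 | (0 < r)%N) expR (- w) ^+ r)).
  rewrite mulr_sumr big_mkcond [leRHS]big_mkcond /=; apply: ler_sum => r _.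
  case: (0 < r)%N => //=; case: ifP => _; last by rewrite mulr_ge0 ?exprn_ge0
    ?expR_ge0.
  by rewrite mulrC divfK // gt_eqF // ltr0n bin_gt0 -ltnS ltn_ord.
have y2 : 2 * expR (- w) <= 1.
  rewrite expRN ler_pdivrMr ?expR_gt0 // mul1r.
  by apply: le_trans (expR_ge1Dx _); lra.
have y4 : expR (- w) <= eps / 4.
  rewrite -(lnK (x := eps / 4)) ?posrE ?divr_gt0 // ler_expR /w.
  by have := ler_norm (- ln (eps / 4)); rewrite normrN; lra.
have := geometric_sum_le n (expR_ge0 (- w)) y2.
have := exprn_ge0 n.+1 (expR_ge0 (- w)).
lra.
Qed.

Lemma expR_ge_pow4 (l : R) : 0 <= l -> l ^+ 4 <= 256 * expR l.
Proof.
move=> l0; have -> : expR l = expR (l / 4) ^+ 4.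
  by rewrite -expRM_natl; congr expR; field.
have -> : 256 = 4 ^+ 4 :> R by ring.
rewrite -exprMn; apply: lerXn2r; rewrite ?nnegrE ?mulr_ge0 ?expR_ge0 //.
by have := expR_ge1Dx (l / 4); lra.
Qed.

(** Inverted, a single factor reads 1 / (1 - v) <= 1 + v + 2 v^2, valid for v <= 1/2. *)
Lemma expr_1B_ge (v : R) m : 0 <= v -> 2 * v <= 1 ->
  expR (- (m%:R * (v + 2 * v ^+ 2))) <= (1 - v) ^+ m.
Proof.
move=> v0 v1; rewrite -mulrN expRM_natl; apply: lerXn2r;
  rewrite ?nnegrE ?expR_ge0 //.
  by lra.
rewrite expRN -lef_pV2 ?posrE ?invr_gt0 ?expR_gt0 //; last by lra.
rewrite invrK; apply: le_trans (expR_ge1Dx _).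
rewrite -[leLHS]mul1r ler_pdivrMr; last by lra.
by nra.
Qed.

Lemma prob_connected_le_eps eps : 0 < eps ->
  exists A : R, forall n K P, (0 < K)%N -> (K <= P)%N ->
    A <= ln n%:R -> n%:R * (K%:R ^+ 2 / P%:R) - ln n%:R <= - A ->
    prob_connected R n K P <= eps.
Proof.
(* The three summands serve the numerical estimates, the bound 8 v <= eps / 2, and the bound eps / 2
   on the inverse mean number of isolated nodes. *)
move=> e0; exists (32 + 4 / eps + `|ln (eps / 2)|).
move=> n K P K0 KP; set l := ln n%:R; set v := K%:R ^+ 2 / P%:R => hl hx.
have nle := normr_ge0 (ln (eps / 2)).
have ie : 0 < 4 / eps by rewrite divr_gt0.
have l32 : 32 <= l by lra.
have lie : 4 <= l * eps by rewrite -ler_pdivrMr //; lra.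
have n0 : 0 < n%:R :> R.
  by rewrite lt_neqAle ler0n andbT; apply: contraTneq l32 => n0;
    rewrite /l -n0 ln0 // -ltNge; lra.
have nE : n%:R = expR l by rewrite lnK ?posrE.
have v0 : 0 <= v by rewrite divr_ge0 ?sqr_ge0.
have n4 : l ^+ 4 <= 256 * n%:R by rewrite nE; apply: expR_ge_pow4; lra.
have nv : n%:R * v <= l by lra.
(* From l >= 32 one gets 1024 l^2 <= l^4 <= 256 n. *)
have n_ge : 4 * l ^+ 2 <= n%:R.
  have : 1024 * l ^+ 2 <= l ^+ 2 * l ^+ 2 by rewrite ler_wpM2r ?sqr_ge0 //; nra.
  by rewrite -exprD; lra.
have lv : 4 * (l * v) <= 1.
  have : l * (l * (4 * v)) <= l * 1.
    rewrite mulr1; apply: le_trans nv.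
    by rewrite (_ : l * _ = 4 * l ^+ 2 * v) ?ler_wpM2r //; ring.
  by rewrite ler_pM2l; lra.
have v1 : 128 * v <= 1 by nra.
have nv2 : n%:R * (2 * v ^+ 2) <= 1.
  rewrite (_ : _ * _ = 2 * ((n%:R * v) * v)); last by ring.
  have : n%:R * v * v <= l * v by rewrite ler_wpM2r.
  by lra.
set q := subset_prob R K P (P - K).
(* Two rings meet with probability at most K^2 / P. *)
have qv : 1 - v <= q by have := subset_prob_ge R KP K0 KP; rewrite -expr2.
have q0 : 0 < q by lra.
have n2 : (1 < n)%N.
  rewrite -(ltr_nat R) nE; apply: lt_le_trans (expR_ge1Dx _); lra.
have q1 : q <= 1.
  have := subset_prob_le_exp R KP (leq_subr K P); move=> h; apply: (le_trans h).
  by rewrite exprn_ile1 ?divr_ge0 // ler_pdivrMr ?mul1r ?ler_nat ?leq_subr //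
    ltr0n (leq_trans K0).
have moment := @prob_connected_second_moment R n K P K0 KP n2 q0;
  cbv zeta in moment.
apply: (le_trans moment); rewrite -/q.
have t1 : (n%:R * q ^+ n.-1)^-1 <= eps / 2.
  have muE : expR (l - n%:R * (v + 2 * v ^+ 2)) <= n%:R * q ^+ n.-1.
    rewrite expRD -nE; apply: ler_wpM2l; first exact: ltW.
    apply: (le_trans (expr_1B_ge n v0 _)); first by lra.
    apply: (@le_trans _ _ (q ^+ n)); first by apply: lerXn2r; rewrite ?nnegrE; lra.
    by rewrite -{1}(prednK (ltnW n2)) exprS ler_piMl // exprn_ge0 ?ltW.
  have mu0 := lt_le_trans (expR_gt0 _) muE.
  apply: (@le_trans _ _ (expR (- (l - n%:R * (v + 2 * v ^+ 2))))).
    by rewrite expRN lef_pV2 ?posrE ?expR_gt0.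
  rewrite -(lnK (x := eps / 2)) ?posrE ?divr_gt0 // ler_expR.
  by have := ler_norm (- ln (eps / 2)); rewrite normrN mulrDr; lra.
have t2 : q ^- 2 - 1 <= 8 * v.
  have : q ^- 2 <= (1 - v) ^- 2.
    rewrite lef_pV2 ?posrE ?exprn_gt0 //; last by lra.
    by apply: lerXn2r; rewrite ?nnegrE; lra.
  have : (1 - v) ^- 2 <= 1 + 8 * v.
    rewrite -[leLHS]mul1r ler_pdivrMr ?exprn_gt0 //; last by lra.
    by nra.
  by lra.
have t3 : 8 * v <= eps / 2.
  have : l * (8 * v) <= l * (eps / 2) by nra.
  by rewrite ler_pM2l; lra.
by lra.
Qed.

End Asymptotics.

Local Open Scope classical_set_scope.

Theorem theorem1 (R : realType) (P K : nat -> nat)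
    (scalingPK : scaling P K) (admissibleK : admissible K) :
  (deviation R P K @ \oo --> -oo ->
     (fun n => prob_connected R n (K n) (P n)) @ \oo --> (0 : R)) /\
  ((exists sigma : R, 0 < sigma /\
      \forall n \near \oo, sigma * n%:R <= (P n)%:R) ->
   deviation R P K @ \oo --> +oo ->
     (fun n => prob_connected R n (K n) (P n)) @ \oo --> (1 : R)).
Proof.
split=> [/cvgrNyPle dev | [sigma [s0 Psigma]] /cvgryPge dev].
  apply/cvgrPdist_le => eps e0.
  have [A hA] := prob_connected_le_eps e0.
  near=> n.
  have K0 : (0 < K n)%N by apply: (@ltn_trans 1) => //; near: n.
  rewrite sub0r normrN ger0_norm ?prob_connected_ge0 //.
  apply: (hA _ _ _ K0 (scalingPK n)); near: n; first exact: near_ln_ge.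
  exact: dev.
apply/cvgrPdist_le => eps e0.
have [A hA] := prob_connected_ge e0 s0.
near=> n.
have K0 : (0 < K n)%N by apply: (@ltn_trans 1) => //; near: n.
rewrite ger0_norm ?subr_ge0 ?prob_connected_le1 // lerBlDr -lerBlDl.
apply: (hA _ _ _ K0 (scalingPK n)); near: n => //; exact: near_ln_ge.
Unshelve. all: by end_near.
Qed.
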